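(* Let $H=\{h_0=0,h_1,\dots,h_{n-1},h_n,\rightarrow\}$ be an Arf numerical semigroup and let $x\in \mathrm{G}(H)$ be a gap of $H$. Assume that $h_i<x<h_{i+1}$ with $0\le i\le n-1$. Then $x\in \mathrm{ArfG}(H)$ if and only if $x\in \mathrm{SG}(H)$, $2x-h_i\in H$ and $2h_{i+1}-x\in H$.
   Context: $\mathbb{N}$ is the set of non-negative integers. A numerical semigroup is a subset $H\subseteq\mathbb{N}$ that contains $0$, is closed under addition, and has finite complement in $\mathbb{N}$. It is Arf if $2a-b\in H$ for all $a,b\in H$ with $a\ge b$ (equivalently $a+b-c\in H$ for all $a\ge b\ge c$ in $H$). The notation $H=\{h_0=0,h_1,\dots,h_n,\rightarrow\}$ means that $h_0<h_1<\dots<h_n$ are the small elements of $H$ listed increasingly, $h_n$ being the conductor of $H$ (the least element such that all integers $\ge h_n$ belong to $H$). $\mathrm{G}(H)=\mathbb{N}\setminus H$ is the set of gaps. For $x,y\in\mathbb{Z}$ write $x\le_H y$ if $y-x\in H$; $\mathrm{PF}(H)$ (pseudo-Frobenius numbers) is the set of maximal elements of $\mathbb{Z}\setminus H$ with respect to $\le_H$, and $\mathrm{SG}(H)=\{x\in \mathrm{PF}(H): 2x\in H\}$ is the set of special gaps. For $H$ Arf, the set of Arf special gaps is $\mathrm{ArfG}(H)=\{x\in \mathrm{SG}(H): H\cup\{x\}\text{ is an Arf numerical semigroup}\}$. *)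

(* Defs.v *)
From mathcomp Require Import all_boot all_order all_algebra.
From mathcomp Require Import boolp classical_sets functions cardinality.

Set Implicit Arguments.
Unset Strict Implicit.
Unset Printing Implicit Defensive.

Local Open Scope classical_set_scope.

Definition numerical_semigroup (H : set nat) : Prop :=
  [/\ H 0, forall a b, H a -> H b -> H (a + b) & finite_set (~` H)].

(* The truncated subtraction is exact here, since b <= a <= 2 * a. *)
Definition arf_semigroup (H : set nat) : Prop :=
  numerical_semigroup H /\
  forall a b, H a -> H b -> b <= a -> H (2 * a - b).

Definition is_conductor (H : set nat) (c : nat) : Prop :=
  (forall m, c <= m -> H m) /\
  forall c', (forall m, c' <= m -> H m) -> c <= c'.

(* H = {h 0 = 0, h 1, ..., h n, ->}; the values of h beyond n are
   irrelevant. *)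
Definition small_elements (H : set nat) (n : nat) (h : nat -> nat) : Prop :=
  [/\ h 0 = 0,
      forall i, i < n -> h i < h i.+1,
      is_conductor H (h n) &
      forall m, m <= h n -> (H m <-> exists2 i, i <= n & m = h i)].

Definition gaps (H : set nat) : set nat := ~` H.

Definition int_set (H : set nat) : set int := Posz @` H.

Definition le_semigroup (H : set nat) (x y : int) : Prop :=
  int_set H (y - x)%R.

(* Maximal elements are taken in all of the integers, so that for instance
   pseudo_frobenius setT = [set -1]. *)
Definition pseudo_frobenius (H : set nat) : set int :=
  [set x | ~ int_set H x /\
           forall y, ~ int_set H y -> le_semigroup H x y -> y = x].

Definition special_gaps (H : set nat) : set int :=
  [set x | pseudo_frobenius H x /\ int_set H (2 * x)%R].

(* Special gaps are nonnegative because 2 * x lies in H, so nothing is lost by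
   letting x range over nat. *)
Definition arf_special_gaps (H : set nat) : set nat :=
  [set x | special_gaps H (Posz x) /\ arf_semigroup (H `|` [set x])].

(* Main.v *)
Require Import Defs.
From mathcomp Require Import all_boot all_order all_algebra.
From mathcomp Require Import boolp classical_sets functions cardinality.
From mathcomp Require Import zify.

(** The three-term form a + b - c of the Arf condition follows from the two-term
    form by a Euclidean descent on b - c.  Since h_i and h_(i+1) are the
    neighbours of x in H, the conditions 2a - x and 2x - b in H, for elements
    a > x > b of H, then reduce to the extreme cases a = h_(i+1) and b = h_i. *)

Lemma int_setE (H : set nat) (m : nat) : int_set H (Posz m) <-> H m.
Proof. by split=> [[k Hk [<-]]|Hm] //; exists m. Qed.

(** Reflecting a term of the progression in the next one yields the term after it, so the induction
    carries two consecutive terms. *)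
Lemma arf_progression (H : set nat) (arfH : arf_semigroup H) (c d : nat) :
  H c -> H (c + d) -> forall k, H (c + k * d).
Proof.
move=> Hc Hcd k; suff [] : H (c + k * d) /\ H (c + k.+1 * d) by [].
elim: k => [|k [IH0 IH1]]; first by rewrite mul0n addn0 mul1n.
split=> //; have := arfH.2 _ _ IH1 IH0.
rewrite (_ : 2 * (c + k.+1 * d) - (c + k * d) = c + k.+2 * d); last by nia.
by apply; nia.
Qed.

(** With [b = c + d] this is the three-term form, stated without truncated subtraction. *)
Lemma arf_add_diff (H : set nat) (arfH : arf_semigroup H) (a c d : nat) :
  H a -> H c -> H (c + d) -> c <= a -> H (a + d).
Proof.
elim/ltn_ind: d a c => d IH a c Ha Hc Hcd le_ca.
have [->|d_gt0] := posnP d; first by rewrite addn0.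
set k := (a - c) %/ d; set e := (a - c) %% d.
have aE : a = c + k * d + e by rewrite -addnA -divn_eq subnKC.
have Hprog := arf_progression H arfH c d Hc Hcd.
(* Exchanging the roles of a and c + (k+1)d turns the difference d into e < d. *)
have -> : a + d = c + k.+1 * d + e by rewrite aE mulSn; lia.
apply: (IH e (ltn_pmod _ d_gt0) _ (c + k * d)) => //; first by rewrite -aE.
by rewrite leq_add2l leq_mul2r leqnSn orbT.
Qed.

Lemma small_elements_homo (H : set nat) (n : nat) (h : nat -> nat) (j k : nat) :
  small_elements H n h -> j <= k -> k <= n -> h j <= h k.
Proof.
move=> [_ hS _ _] le_jk; elim: k le_jk => [|k IH]; first by rewrite leqn0 => /eqP->.
rewrite leq_eqVlt ltnS => /predU1P[->//|le_jk] lt_kn.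
exact: leq_trans (IH le_jk (ltnW lt_kn)) (ltnW (hS _ lt_kn)).
Qed.

Lemma small_elements_mem (H : set nat) (n : nat) (h : nat -> nat) (j : nat) :
  small_elements H n h -> j <= n -> H (h j).
Proof.
move=> hH le_jn; have [_ _ _ hP] := hH.
by apply/hP; [exact: small_elements_homo hH _ _ | exists j].
Qed.

Lemma small_elements_gap (H : set nat) (n : nat) (h : nat -> nat) (i m : nat) :
  small_elements H n h -> i < n -> H m -> m <= h i \/ h i.+1 <= m.
Proof.
move=> hH lt_in Hm; have [_ _ _ hP] := hH.
have [lt_nm|le_mn] := ltnP (h n) m.
  right; apply: leq_trans (ltnW lt_nm).
  exact: small_elements_homo hH _ _.
have [j le_jn ->] := (hP m le_mn).1 Hm.
have [le_ji|lt_ij] := leqP j i; [left|right].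
  exact: small_elements_homo hH le_ji (ltnW lt_in).
exact: small_elements_homo hH lt_ij le_jn.
Qed.

(** If [x + a] were outside [H], it would lie strictly above [x] for the semigroup order, against
    maximality of [x]. *)
Lemma special_gap_add (H : set nat) (x a : nat) :
  special_gaps H (Posz x) -> H a -> 0 < a -> H (x + a).
Proof.
move=> [[_ maxx] _] Ha a_gt0; apply: contrapT => nHxa.
have /eqP : Posz (x + a) = Posz x; last by lia.
apply: maxx; first by move/int_setE.
by exists a => //; lia.
Qed.

Lemma special_gap_numerical_semigroup (H : set nat) (x : nat) :
  numerical_semigroup H -> special_gaps H (Posz x) ->
  numerical_semigroup (H `|` [set x])%classic.
Proof.
move=> [H0 HD finH] xSG.
have Hxx : H (x + x).
  have [_] := xSG; rewrite (_ : (2 * Posz x)%R = Posz (x + x)); last by lia.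
  by move/int_setE.
have HxD a : H a -> (H `|` [set x])%classic (x + a).
  have [->|a_gt0] := posnP a; first by rewrite addn0; right.
  by move=> Ha; left; exact: special_gap_add.
split; first by left.
- move=> a b [Ha|->] [Hb|->]; [by left; exact: HD | | exact: HxD | by left].
  by rewrite addnC; exact: HxD.
- by apply: sub_finite_set finH => y nHxy Hy; apply: nHxy; left.
Qed.

Theorem proposition2p4 (H : set nat) (n : nat) (h : nat -> nat) (x i : nat)
  (arfH : arf_semigroup H) (hH : small_elements H n h)
  (xG : gaps H x) (lt_in : i < n) (lt_hi_x : h i < x) (lt_x_hi1 : x < h i.+1) :
  arf_special_gaps H x <->
  [/\ special_gaps H (Posz x), H (2 * x - h i) & H (2 * h i.+1 - x)].
Proof.
have Hhi : H (h i) := small_elements_mem _ _ _ _ hH (ltnW lt_in).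
have Hhi1 : H (h i.+1) := small_elements_mem _ _ _ _ hH lt_in.
split=> [[xSG [_ arfHx]]|[xSG Hlo Hhi2]].
  split=> //.
  (* The Arf condition only gives membership in [H] with [x] added; the value [x] itself would force
     [x = h i]. *)
  - have [||//|/= eqx] := arfHx x (h i) _ _ (ltnW lt_hi_x); [by right|by left|].
    by exfalso; lia.
  - have [||//|/= eqx] := arfHx (h i.+1) x _ _ (ltnW lt_x_hi1); [by left|by right|].
    by exfalso; lia.
split=> //; split; first exact: special_gap_numerical_semigroup arfH.1 xSG.
move=> a b [Ha|->] [Hb|->] le_ba.
- by left; exact: arfH.2.
- left; have le_a : h i.+1 <= a.
    have [le_ai|//] := small_elements_gap _ _ _ _ _ hH lt_in Ha.
    by exfalso; lia.
  have Hstep y : H y -> h i.+1 <= y -> H (y + (a - h i.+1)).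
    by move=> Hy; apply: arf_add_diff => //; rewrite subnKC.
  (* Two translations by [a - h i.+1] lead from the extreme case to [a]; they stay in [H] because
     [2 * h i.+1 - x] exceeds [h i.+1]. *)
  have -> : 2 * a - x = 2 * h i.+1 - x + (a - h i.+1) + (a - h i.+1) by lia.
  by apply: (Hstep); [apply: (Hstep) => //; lia | lia].
- left; have le_b : b <= h i.
    have [//|le_ib] := small_elements_gap _ _ _ _ _ hH lt_in Hb.
    by exfalso; lia.
  (* Here one translation by the difference of [b] and [h i] suffices, as
     [b <= h i < 2 * x - h i]. *)
  have -> : 2 * x - b = 2 * x - h i + (h i - b) by lia.
  by apply: (arf_add_diff H arfH _ b) => //; [rewrite subnKC | lia].
- by right => /=; lia.
Qed.
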